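(* Let $f$ be a decomposable CN function with CN form $f=[g:g_1,\dots,g_r]$ and decomposition $((\bm x_1,\bm y_1),\dots,(\bm x_p,\bm y_p))$ of $(\bm x,\bm y)$, and let $(\bm x^*,\bm y^* )=((\bm x_1^*,\bm y_1^* ),\dots,(\bm x_p^*,\bm y_p^* ))\in X(f)$. For each $j=1,\dots,p$ consider the problem $$(\mathrm{WCNP})_j(\bm x_j^*,\bm y_j^* ):\quad\min\ \nabla_jg(\bm x^*,\bm y^* )^\top\bm d_j\quad\text{s.t. }\bm d_j\in T_j(\bm x_j^*,\bm y_j^* ).$$ If for all $j=1,\dots,p$, $\bm d_j^*$ is an optimal solution to $(\mathrm{WCNP})_j(\bm x_j^*,\bm y_j^* )$ such that $\nabla_jg(\bm x^*,\bm y^* )^\top\bm d_j^*\ge0$, then $(\bm x^*,\bm y^* )$ is an optimal solution to (CNP) and $\bm x^*$ is an optimal solution to (CNO). Furthermore, if there is a $\bm d'$ such that $\nabla g_i(\bm x^*,\bm y^* )^\top\bm d'<0$, $i=1,\dots,r$, then there are $\alpha_i^*\ge0$, $i=1,\dots,r$, such that $$\nabla g(\bm x^*,\bm y^* )+\sum_{i=1}^r\alpha_i^*\nabla g_i(\bm x^*,\bm y^* )=0.$$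
   Context: Let $f:\mathbb{R}^n\to\mathbb{R}$ be nonconvex and let $g,g_1,\dots,g_r:\mathbb{R}^n\times\mathbb{R}^m\to\mathbb{R}$ ($r\ge1$) be convex and twice differentiable. Put $X(\bm g)=\{(\bm x,\bm y): g_i(\bm x,\bm y)=0,\ i=1,\dots,r\}$. $f$ is a CN (convertible nonconvex) function with CN form $f=[g:g_1,\dots,g_r]$ if for each $\bm x\in\mathbb{R}^n$ there is $\bm y\in\mathbb{R}^m$ with $(\bm x,\bm y)\in X(\bm g)$ and $f(\bm x)=g(\bm x,\bm y)=\min_{(\bm x,\bm y')\in X(\bm g)}g(\bm x,\bm y')$. $X(f)=\{(\bm x,\bm y)\in X(\bm g): f(\bm x)=g(\bm x,\bm y)\}$. (CNO): $\min f(\bm x)$ s.t. $\bm x\in\mathbb{R}^n$. (CNP): $\min g(\bm x,\bm y)$ s.t. $g_i(\bm x,\bm y)=0$, $i=1,\dots,r$. ''Optimal solution'' means global minimizer. Decomposition: the variables of $(\bm x,\bm y)\in\mathbb{R}^n\times\mathbb{R}^m$ are rearranged into $p$ blocks ($2\le p\le\min\{n,m\}$) $((\bm x_1,\bm y_1),\dots,(\bm x_p,\bm y_p))$, $\bm x_j\in\mathbb{R}^{p_j}$, $\bm y_j\in\mathbb{R}^{q_j}$, $\sum_jp_j=n$, $\sum_jq_j=m$, with no variable common to two blocks. $f$ is decomposable if each of $g_1,\dots,g_r$ depends on the variables of one block only, so that the constraints can be written $\bm g(\bm x,\bm y)=(\bm g_1(\bm x_1,\bm y_1),\dots,\bm g_p(\bm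 x_p,\bm y_p))=0$. $\nabla_j$ denotes the gradient with respect to the block $(\bm x_j,\bm y_j)$, the other blocks being fixed. $T_j(\bm x_j,\bm y_j)=\{\bm d_j\in\mathbb{R}^{p_j}\times\mathbb{R}^{q_j}:\nabla_jg_i(\bm x,\bm y)^\top\bm d_j\le0,\ i=1,\dots,r\}$. *)

(* Defs.v *)
From HB Require Import structures.
From mathcomp Require Import all_boot all_order all_algebra.
From mathcomp Require Import all_classical all_reals all_analysis.
Set Implicit Arguments.
Unset Strict Implicit.
Unset Printing Implicit Defensive.
Import Order.TTheory GRing.Theory Num.Theory.
Import numFieldNormedType.Exports.
Local Open Scope classical_set_scope.
Local Open Scope ring_scope.

(* Elements of [pt R n m] are the pairs (x, y) of R^n x R^m. *)
Notation pt R n m := ('rV[R]_n * 'rV[R]_m)%type.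

Section Defs.
Context {R : realType}.

Definition dot n m (u v : pt R n m) : R :=
  \sum_i u.1 0 i * v.1 0 i + \sum_i u.2 0 i * v.2 0 i.

Definition grad n m (h : pt R n m -> R) (w : pt R n m) : pt R n m :=
  (\row_i 'D_(delta_mx 0 i, 0) h w, \row_i 'D_(0, delta_mx 0 i) h w).

Definition twice_differentiable n m (h : pt R n m -> R) : Prop :=
  (forall w, differentiable h w) /\ (forall w, differentiable (grad h) w).

Definition minimizer T (S : set T) (F : T -> R) (w : T) : Prop :=
  S w /\ forall w', S w' -> F w <= F w'.

Definition feasible n m r (gs : 'I_r -> pt R n m -> R) : set (pt R n m) :=
  [set w | forall i, gs i w = 0].

Record CN_form n m r (f : 'rV[R]_n -> R) (g : pt R n m -> R)
    (gs : 'I_r -> pt R n m -> R) : Prop := {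
  CN_nonconvex : ~ convex_function setT f;
  CN_convex : convex_function setT g;
  CN_convexs : forall i, convex_function setT (gs i);
  CN_diff : twice_differentiable g;
  CN_diffs : forall i, twice_differentiable (gs i);
  CN_min : forall x, exists y,
    minimizer [set y' | feasible gs (x, y')] (fun y' => g (x, y')) y
    /\ f x = g (x, y) }.

Definition CN_graph n m r (f : 'rV[R]_n -> R) (g : pt R n m -> R)
    (gs : 'I_r -> pt R n m -> R) : set (pt R n m) :=
  feasible gs `&` [set w | f w.1 = g w].

(* [xvar j k] is the position in x of the k-th coordinate of x_j.  The two
   bijections say that every coordinate lies in exactly one block, so that
   \sum_j xdim j = n and \sum_j ydim j = m. *)
Record decomposition (n m p : nat) := Decomposition {
  xdim : 'I_p -> nat;
  ydim : 'I_p -> nat;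
  xvar : forall j, 'I_(xdim j) -> 'I_n;
  yvar : forall j, 'I_(ydim j) -> 'I_m;
  xvar_bij : bijective (fun s : {j : 'I_p & 'I_(xdim j)} => xvar (tagged s));
  yvar_bij : bijective (fun s : {j : 'I_p & 'I_(ydim j)} => yvar (tagged s)) }.

Notation block_pt D j := (pt R (xdim D j) (ydim D j)).

Definition block n m p (D : decomposition n m p) j (w : pt R n m) :
    block_pt D j :=
  (colsub (@xvar _ _ _ D j) w.1, colsub (@yvar _ _ _ D j) w.2).

Definition overwrite a n (e : 'I_a -> 'I_n) (u : 'rV[R]_a) (v : 'rV[R]_n) :
    'rV[R]_n :=
  \row_i if [pick k | e k == i] is Some k then u 0 k else v 0 i.

Definition set_block n m p (D : decomposition n m p) j (w : pt R n m)
    (z : block_pt D j) : pt R n m :=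
  (overwrite (@xvar _ _ _ D j) z.1 w.1, overwrite (@yvar _ _ _ D j) z.2 w.2).

Definition block_grad n m p (D : decomposition n m p) j (h : pt R n m -> R)
    (w : pt R n m) : block_pt D j :=
  grad (fun z => h (set_block w z)) (block D j w).

Definition decomposable n m p r (D : decomposition n m p)
    (gs : 'I_r -> pt R n m -> R) : Prop :=
  forall i, exists j, forall w w',
    block D j w = block D j w' -> gs i w = gs i w'.

Definition block_cone n m p r (D : decomposition n m p)
    (gs : 'I_r -> pt R n m -> R) (w : pt R n m) j : set (block_pt D j) :=
  [set d | forall i, dot (block_grad D j (gs i) w) d <= 0].

End Defs.

Arguments block_cone {R n m p r} D gs w j.

Notation block_pt R D j := (pt R (xdim D j) (ydim D j)).

(* Main.v *)
Require Import Defs.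
From HB Require Import structures.
From mathcomp Require Import all_boot all_order all_algebra.
From mathcomp Require Import all_classical all_reals all_analysis.
From mathcomp Require Import lra ring.
Set Implicit Arguments.
Unset Strict Implicit.
Unset Printing Implicit Defensive.
Import Order.TTheory GRing.Theory Num.Theory.
Import numFieldNormedType.Exports.
Local Open Scope classical_set_scope.
Local Open Scope ring_scope.

(** Convexity turns the equality constraints into first-order information: for
    feasible [w'] the gradient inequality gives
    [0 = g_i w' >= g_i w + <grad g_i w, w' - w>] with [g_i w = 0], so
    [v = w' - w] satisfies [<grad g_i w, v> <= 0] for every [i].

    Directions of this kind split along the blocks.  The block gradient of
    [g_i] is the restriction of its full gradient to the block
    ([block_grad_block]), and it vanishes on all blocks but the one on which
    [g_i] depends ([block_grad_eq0]).  Since the full inner product is the sum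
    of the block inner products ([dot_blocks]), each block of [v] lies in the
    corresponding cone [T_j] ([cone_blocks]).  The minima over the [T_j] being
    nonnegative, summing over [j] yields the first-order condition
    ([first_order_condition]):
    [<grad g w, v> >= 0] as soon as [<grad g_i w, v> <= 0] for all [i].

    The gradient inequality for [g] then gives [g w <= g w'].  Minimality of
    [w.1] for [f] follows because every value of [f] is the value of [g] at a
    feasible point.

    For the multipliers, the first-order condition is the hypothesis of the
    Farkas lemma ([farkas]) for the linear forms [<grad g_i w, .>] and
    [- <grad g w, .>], whose conclusion, tested against every vector, is
    the stationarity equation. *)

(** * The Farkas lemma *)

(** Bartl's algebraic proof, by induction on the number of forms.  If the constraint [a ord0] cannot
    be dropped, some [z0] satisfies the others but has [c z0 > 0], hence
    [a ord0 z0 > 0].  Projecting along [z0] onto the kernel of [a ord0] makes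
    that constraint void, and the coefficients found for the projected forms
    also serve for the original ones; the coefficient of [a ord0] is then
    dictated by the value at [z0]. *)
Lemma farkas (F : realFieldType) (V : lmodType F) (r : nat)
    (a : 'I_r -> V -> F) (c : V -> F) :
  (forall i, scalar (a i)) -> scalar c ->
  (forall v, (forall i, a i v <= 0) -> c v <= 0) ->
  exists alpha : 'I_r -> F,
    (forall i, 0 <= alpha i) /\ forall v, c v = \sum_i alpha i * a i v.
Proof.
elim: r a c => [|r IHr] a c lin_a lin_c ac.
  exists (fun=> 0); split=> // v; rewrite big_ord0.
  have c_le0 u : c u <= 0 by apply: ac => -[].
  (* Both [c v] and [c (- v)] are nonpositive. *)
  have := lin_c (-1) 0 0; rewrite scaler0 addr0 => c0.
  have := lin_c (-1) v 0; have := c_le0 v; have := c_le0 (-1 *: v + 0); lra.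
pose a' i := a (lift ord0 i).
have [/IHr[|//|alpha [alpha_ge0 cE]]|] :=
    pselect (forall v, (forall i, a' i v <= 0) -> c v <= 0).
- by move=> i; exact: lin_a.
- exists (fun i => if unlift ord0 i is Some k then alpha k else 0); split.
    by move=> i; case: unliftP.
  move=> v; rewrite big_ord_recl unlift_none mul0r add0r cE.
  by apply: eq_bigr => i _; rewrite liftK.
move=> /existsNP[z0 /not_implyP[a'z0 /negP]]; rewrite -ltNge => cz0.
have az0 : 0 < a ord0 z0.
  rewrite ltNge; apply/negP => a0z0; have := ac z0.
  rewrite leNgt cz0 => /(_ _)/negP; apply => // i.
  by case: (unliftP ord0 i) => [k ->|->] //; exact: a'z0.
have linB l (ll : scalar l) t u : l (u - t *: z0) = l u - t * l z0.
  by rewrite [RHS]addrC -mulNr -ll scaleNr addrC.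
pose t v := a ord0 v / a ord0 z0.
have tlin s u v : t (s *: u + v) = s * t u + t v.
  by rewrite /t lin_a mulrDl mulrA.
pose proj v := v - t v *: z0.
have projlin s u v : proj (s *: u + v) = s *: proj u + proj v.
  by rewrite /proj tlin scalerDl scalerBr scalerA opprD addrACA.
have [] := IHr (fun i v => a' i (proj v)) (fun v => c (proj v)).
- by move=> i s u v; rewrite projlin /a' lin_a.
- by move=> s u v; rewrite projlin lin_c.
- move=> v a'v; apply: ac => i; case: (unliftP ord0 i) => [k ->|->].
    exact: a'v.
  by rewrite linB // /t divfK ?subrr ?gt_eqF.
move=> alpha [alpha_ge0 cE].
exists (fun i => if unlift ord0 i is Some k then alpha k else
  (c z0 - \sum_k alpha k * a' k z0) / a ord0 z0); split.
  move=> i; case: unliftP => // _.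
  (* [c z0 > 0] whereas [z0] satisfies all the other constraints. *)
  rewrite divr_ge0 ?(ltW az0)// subr_ge0 (le_trans _ (ltW cz0))//.
  by apply: sumr_le0 => k _; rewrite mulr_ge0_le0.
move=> v; rewrite big_ord_recl /= unlift_none.
under [X in _ = _ + X]eq_bigr do rewrite liftK.
have := cE v; rewrite linB // => /eqP; rewrite subr_eq => /eqP ->.
have -> : \sum_i alpha i * a' i (proj v) =
    \sum_i alpha i * a' i v - t v * \sum_i alpha i * a' i z0.
  rewrite mulr_sumr -sumrB; apply: eq_bigr => i _.
  by rewrite linB; [rewrite mulrBr mulrCA | exact: lin_a].
rewrite /t /a'; ring.
Qed.

(** * Directional derivatives *)

(** On the segment from [w] to [w + v] the difference quotients of a convex
    function are at most the one at time 1; let the time tend to 0 from the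
    right. *)
Lemma convex_derive_le (R : realType) (V : normedModType R) (h : V -> R)
    (w v : V) :
  convex_function setT h -> derivable h w v -> 'D_v h w <= h (w + v) - h w.
Proof.
move=> cvx dh.
apply: (cvgr_to_le (cvg_dnbhs_at_right dh)).
near=> t.
have t0 : 0 < t by near: t; exact: nbhs_right_gt.
have t1 : t <= 1 by near: t; exact: nbhs_right_le.
pose s : {i01 R} := @Itv01 R t (ltW t0) t1.
have := cvx s (w + v) w (in_setT _) (in_setT _).
rewrite convRE /conv /= /unstable.onem.
have -> : t *: (w + v) + (1 - t) *: w = t *: v + w.
  by rewrite addrC scalerBl scale1r scalerDr addrA subrK addrC.
rewrite ler_pdivrMl // => cvxt; apply: le_trans (lerD cvxt (lexx _)) _.
lra.
Unshelve. all: by end_near. Qed.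

(** No chain rule is involved: the difference quotients on both sides are the
    same function of [t]. *)
Lemma derive_comp_affine (R : realType) (V W : normedModType R)
    (phi : V -> W) (h : W -> R) (a v : V) (u : W) :
  (forall t : R, phi (t *: v + a) = t *: u + phi a) ->
  'D_v (h \o phi) a = 'D_u h (phi a).
Proof.
move=> phiE; rewrite /derive.
by under eq_fun do rewrite /= phiE.
Qed.

(** * Inner product and gradient *)

Section DotGrad.
Context {R : realType} {n m : nat}.
Implicit Types (u v w : pt R n m) (h : pt R n m -> R).

Lemma dot_scalar u : scalar (dot u).
Proof.
move=> t v w; rewrite /dot /= mulrDr addrACA !mulr_sumr -!big_split /=.
by congr (_ + _); apply: eq_bigr => i _; rewrite !mxE; ring.
Qed.

Lemma dotC u v : dot u v = dot v u.
Proof. by congr (_ + _); apply: eq_bigr => i _; rewrite mulrC. Qed.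

HB.instance Definition _ u :=
  GRing.isLinear.Build R (pt R n m) R *%R (dot u) (dot_scalar u).

Lemma dot0 u : dot 0 u = 0.
Proof. by rewrite dotC linear0. Qed.

Lemma dot_eq0 u : (forall v, dot u v = 0) -> u = 0.
Proof.
move=> u0; have /eqP := u0 u; rewrite /dot.
rewrite paddr_eq0 ?sumr_ge0//; try by move=> i _; rewrite -expr2 sqr_ge0.
rewrite !psumr_eq0; try by move=> i _; rewrite -expr2 sqr_ge0.
case: u {u0} => x y /= /andP[/allP x0 /allP y0].
congr (_, _); apply/rowP => i; rewrite mxE.
  by have := x0 i (mem_index_enum _); rewrite mulf_eq0 orbb => /eqP.
by have := y0 i (mem_index_enum _); rewrite mulf_eq0 orbb => /eqP.
Qed.

Lemma derive_dot_grad h w v : differentiable h w -> 'D_v h w = dot (grad h w) v.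
Proof.
move=> dh; rewrite deriveE //.
have vE : v = \sum_i v.1 0 i *: (delta_mx 0 i, 0)
            + \sum_i v.2 0 i *: (0, delta_mx 0 i).
  rewrite [RHS]surjective_pairing !linearD !linear_sum /= [LHS]surjective_pairing.
  under [X in (_, X + _)]eq_bigr do rewrite scaler0.
  under [X in (_ + X, _)]eq_bigr do rewrite scaler0.
  by rewrite !big1_eq addr0 add0r -!row_sum_delta.
rewrite [in LHS]vE linearD !linear_sum; congr (_ + _); apply: eq_bigr => i _;
by rewrite linearZ /= !mxE deriveE // mulrC.
Qed.

End DotGrad.

(** * Block decomposition *)

Section Blocks.
Context {R : realType} {n m p : nat} (D : decomposition n m p).
Implicit Types (u v w : pt R n m) (h : pt R n m -> R) (j : 'I_p).

Lemma xvar_inj j : injective (xvar (d:=D) (j:=j)).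
Proof.
move=> k k' kk'; have /eqP := @bij_inj _ _ _ (xvar_bij D)
  (Tagged (fun j => 'I_(xdim D j)) k) (Tagged (fun j => 'I_(xdim D j)) k') kk'.
by rewrite eq_Tagged => /eqP.
Qed.

Lemma yvar_inj j : injective (yvar (d:=D) (j:=j)).
Proof.
move=> k k' kk'; have /eqP := @bij_inj _ _ _ (yvar_bij D)
  (Tagged (fun j => 'I_(ydim D j)) k) (Tagged (fun j => 'I_(ydim D j)) k') kk'.
by rewrite eq_Tagged => /eqP.
Qed.

Lemma xvar_block j j' (k : 'I_(xdim D j)) (k' : 'I_(xdim D j')) :
  xvar k = xvar k' -> j = j'.
Proof.
move=> kk'; have /(congr1 tag) := @bij_inj _ _ _ (xvar_bij D)
  (Tagged (fun j => 'I_(xdim D j)) k) (Tagged (fun j => 'I_(xdim D j)) k') kk'.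
by [].
Qed.

Lemma yvar_block j j' (k : 'I_(ydim D j)) (k' : 'I_(ydim D j')) :
  yvar k = yvar k' -> j = j'.
Proof.
move=> kk'; have /(congr1 tag) := @bij_inj _ _ _ (yvar_bij D)
  (Tagged (fun j => 'I_(ydim D j)) k) (Tagged (fun j => 'I_(ydim D j)) k') kk'.
by [].
Qed.

(** The blocks partition the coordinates, so this is a reindexing of the two
    sums along the bijections that are part of the decomposition. *)
Lemma dot_blocks u v : dot u v = \sum_j dot (block D j u) (block D j v).
Proof.
rewrite /dot big_split /= !sig_big_dep /=; congr (_ + _).
  rewrite (reindex _ (onW_bij _ (xvar_bij D))) /=.
  by apply: eq_bigr => s _; rewrite !mxE.
rewrite (reindex _ (onW_bij _ (yvar_bij D))) /=.
by apply: eq_bigr => s _; rewrite !mxE.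
Qed.

(** Moving the overwritten coordinates along a line moves the whole vector
    along a line; this is what makes [set_block w] affine. *)
Lemma overwrite_affine a N (e : 'I_a -> 'I_N) (x : 'rV[R]_a) (y : 'rV[R]_N) t :
  overwrite e (t *: x + colsub e y) y = t *: overwrite e x 0 + y.
Proof.
apply/rowP => i; rewrite !mxE; case: pickP => [k /eqP <-|_]; rewrite ?mxE //.
by rewrite mulr0 add0r.
Qed.

Lemma overwrite_colsub a N (e : 'I_a -> 'I_N) (y : 'rV[R]_N) :
  overwrite e (colsub e y) y = y.
Proof. by have := overwrite_affine e 0 y 0; rewrite !scale0r !add0r. Qed.

Lemma overwrite_delta a N (e : 'I_a -> 'I_N) k :
  injective e -> overwrite e (delta_mx 0 k) 0 = delta_mx 0 (e k) :> 'rV[R]_N.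
Proof.
move=> e_inj; apply/rowP => i; rewrite !mxE /=.
case: pickP => [k' /eqP <-|ei]; rewrite ?mxE /= ?(inj_eq e_inj) //.
by rewrite eq_sym ei.
Qed.

Lemma overwrite0 a N (e : 'I_a -> 'I_N) : overwrite e 0 0 = 0 :> 'rV[R]_N.
Proof. by apply/rowP => i; rewrite !mxE; case: pickP => *; rewrite ?mxE. Qed.

(** [set_block w] is affine with linear part [set_block 0], the embedding of a
    block by zero in the other blocks. *)
Lemma derive_set_block j h w z :
  'D_z (fun z => h (set_block w z)) (block D j w) = 'D_(set_block 0 z) h w.
Proof.
have wE : set_block w (block D j w) = w.
  by rewrite /set_block /= !overwrite_colsub -surjective_pairing.
rewrite -[in RHS]wE; apply: (derive_comp_affine (phi := set_block w)) => t.
rewrite wE [RHS]surjective_pairing /set_block /=.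
by rewrite !overwrite_affine.
Qed.

Lemma block_grad_block j h w : block_grad D j h w = block D j (grad h w).
Proof.
rewrite /block_grad /grad /block /=; congr (_, _); apply/rowP => k;
rewrite !mxE derive_set_block /set_block /= overwrite0 overwrite_delta //.
  exact: xvar_inj.
exact: yvar_inj.
Qed.

Lemma block_set_block j j' w (z : block_pt R D j) :
  j' != j -> block D j' (set_block w z) = block D j' w.
Proof.
move=> /negP j'j; rewrite /block /set_block /=.
congr (_, _); apply/rowP => k; rewrite !mxE; case: pickP => // k' /eqP kk'.
  by case: j'j; rewrite (xvar_block kk').
by case: j'j; rewrite (yvar_block kk').
Qed.

Lemma block_grad_eq0 j j' h w :
  (forall u v, block D j' u = block D j' v -> h u = h v) -> j' != j ->
  block_grad D j h w = 0.
Proof.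
move=> h_block j'j; rewrite /block_grad.
have -> : (fun z => h (set_block w z)) = cst (h w) :> (block_pt R D j -> R).
  by apply/funext => z; apply: h_block; exact: block_set_block.
by rewrite /grad; congr (_, _); apply/rowP => k; rewrite !mxE derive_cst.
Qed.

(** Fix [i] and the block [j'] on which [gs i] depends.  Outside [j'] the block
    gradient of [gs i] is zero; on [j'] all of [<grad (gs i) w, v>] is
    concentrated, as the other terms of its sum over the blocks are zero. *)
Lemma cone_blocks r (gs : 'I_r -> pt R n m -> R) w v :
  decomposable D gs -> (forall i, dot (grad (gs i) w) v <= 0) ->
  forall j, block_cone D gs w j (block D j v).
Proof.
move=> dec gv j i; have [j' gsj'] := dec i.
have [<-|j'j] := eqVneq j' j; last by rewrite (block_grad_eq0 w gsj') // dot0.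
apply: le_trans (gv i); rewrite [leRHS]dot_blocks (bigD1 j') //=.
rewrite block_grad_block big1 ?addr0 // => k.
by rewrite eq_sym -block_grad_block => /(block_grad_eq0 w gsj') ->; rewrite dot0.
Qed.

(** The point where the block problems are glued: each contributes a
    nonnegative term to the sum of [dot_blocks]. *)
Lemma first_order_condition r (g : pt R n m -> R) (gs : 'I_r -> pt R n m -> R)
    w (d : forall j, block_pt R D j) :
  decomposable D gs ->
  (forall j, minimizer (block_cone D gs w j) (dot (block_grad D j g w)) (d j)
     /\ 0 <= dot (block_grad D j g w) (d j)) ->
  forall v, (forall i, dot (grad (gs i) w) v <= 0) -> 0 <= dot (grad g w) v.
Proof.
move=> dec opt v /(cone_blocks dec) vT; rewrite (dot_blocks (grad g w)).
apply: sumr_ge0 => j _; have [[_ dmin] dge0] := opt j.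
by rewrite -block_grad_block; apply: le_trans dge0 _; apply: dmin; exact: vT.
Qed.

End Blocks.

(** * Optimality and multipliers *)

Lemma convex_grad_le (R : realType) n m (h : pt R n m -> R) w w' :
  convex_function setT h -> differentiable h w ->
  dot (grad h w) (w' - w) <= h w' - h w.
Proof.
move=> cvx dh; rewrite -derive_dot_grad //.
have := convex_derive_le cvx (@diff_derivable _ _ _ h w (w' - w) dh).
by rewrite (addrC w) subrK.
Qed.

Theorem theorem4p1 (R : realType) (n m p r : nat)
    (f : 'rV[R]_n -> R) (g : pt R n m -> R) (gs : 'I_r -> pt R n m -> R)
    (D : decomposition n m p) (w : pt R n m)
    (d : forall j : 'I_p, block_pt R D j) :
  (2 <= p <= minn n m)%N -> (0 < r)%N ->
  CN_form f g gs -> decomposable D gs -> CN_graph f g gs w ->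
  (forall j : 'I_p,
     minimizer (block_cone D gs w j) (dot (block_grad D j g w)) (d j)
     /\ 0 <= dot (block_grad D j g w) (d j)) ->
  (minimizer (feasible gs) g w /\ minimizer setT f w.1)
  /\ ((exists d' : pt R n m, forall i, dot (grad (gs i) w) d' < 0) ->
      exists alpha : 'I_r -> R,
        (forall i, 0 <= alpha i)
        /\ grad g w + \sum_i alpha i *: grad (gs i) w = 0).
Proof.
move=> _ _ cn dec [wX fgw] opt.
have foc := first_order_condition dec opt.
have wmin w' : feasible gs w' -> g w <= g w'.
  move=> w'X; rewrite -subr_ge0.
  apply: le_trans (convex_grad_le w' (CN_convex cn) ((CN_diff cn).1 w)).
  apply: foc => i; apply: le_trans (convex_grad_le w' (CN_convexs cn i) _) _.
    exact: (CN_diffs cn i).1.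
  by rewrite wX w'X subrr.
split.
  split=> //; split=> // x _.
  have [y [[yX _] ->]] := CN_min cn x.
  by rewrite fgw; exact: wmin.
(* The form is negated: Farkas is stated for constraints and consequences of
   the same sign. *)
move=> _; have [|||alpha [alpha_ge0 gE]] := @farkas R (pt R n m) r
    (fun i => dot (grad (gs i) w)) (fun v => - dot (grad g w) v).
- by move=> i; exact: dot_scalar.
- by move=> t u v /=; rewrite dot_scalar opprD mulrN.
- by move=> v gv; rewrite oppr_le0 foc.
exists alpha; split=> //; apply: dot_eq0 => v.
rewrite dotC linearD linear_sum /= dotC -[X in X + _]opprK gE addrC -sumrB.
by rewrite big1 // => i _; rewrite linearZ /= dotC subrr.
Qed.
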